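(* Let $f\le 126$ be a nonnegative integer. Then $f$ is an infertility number if and only if $f\equiv 3\pmod 4$, $f\notin\{95,119\}$, and either $f<27$ or $f\not\equiv 3\pmod{12}$.
   Context: A permutation is an ordering, written in one-line notation, of a finite set of positive integers. West's stack-sorting map $s$ is defined recursively: $s$ sends the empty permutation to itself, and if $\pi=LmR$ is a nonempty permutation with largest entry $m$, then $s(\pi)=s(L)\,s(R)\,m$. The fertility of a permutation $\pi$ is $|s^{-1}(\pi)|$. A fertility number is a nonnegative integer $f$ such that some permutation has fertility $f$; an infertility number is a nonnegative integer that is not a fertility number. *)

(* Defs.v *)
From mathcomp Require Import all_boot.

Set Implicit Arguments.
Unset Strict Implicit.
Unset Printing Implicit Defensive.

(* A permutation in one-line notation: its entries are distinct positive
   integers, but need not form an initial segment {1, ..., n}. *)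
Definition is_permutation (p : seq nat) : bool :=
  uniq p && all (fun x => 0 < x) p.

Definition largest (p : seq nat) : nat := foldr maxn 0 p.

(* [n] is fuel for the recursion s(L m R) = s(L) s(R) m; any [n >= size p]
   gives the same result (lemma [stack_sort_recE]). *)
Fixpoint stack_sort_rec (n : nat) (p : seq nat) : seq nat :=
  match n, p with
  | n'.+1, _ :: _ =>
      let m := largest p in
      let i := index m p in
      stack_sort_rec n' (take i p) ++ stack_sort_rec n' (drop i.+1 p) ++ [:: m]
  | _, _ => [::]
  end.

Definition stack_sort (p : seq nat) : seq nat := stack_sort_rec (size p) p.

(* A preimage of [p] under [stack_sort] is a rearrangement of [p], so it is
   found in the finite list [permutations p]; lemmas [mem_preimages] and
   [uniq_preimages] show that this list enumerates s^{-1}(p) without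
   repetition. *)
Definition preimages (p : seq nat) : seq (seq nat) :=
  [seq q <- permutations p | stack_sort q == p].

Definition fertility (p : seq nat) : nat := size (preimages p).

Definition fertility_number (f : nat) : Prop :=
  exists p : seq nat, is_permutation p /\ fertility p = f.

Definition infertility_number (f : nat) : Prop := ~ fertility_number f.

Lemma leq_largest p x : x \in p -> x <= largest p.
Proof.
elim: p => //= y p IHp; rewrite inE leq_max => /orP[/eqP-> | /IHp ->].
  by rewrite leqnn.
by rewrite orbT.
Qed.

Lemma largest_mem x p : largest (x :: p) \in x :: p.
Proof.
elim: p x => [|y p IHp] x; first by rewrite /= maxn0 inE.
have := IHp y; rewrite [largest (x :: _)]/= -/(largest (y :: p)).
by case: leqP => _ h; rewrite inE ?h ?eqxx ?orbT.
Qed.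

Lemma stack_sort_recE n p : size p <= n -> stack_sort_rec n p = stack_sort p.
Proof.
suff H k : forall n' p', size p' <= k -> size p' <= n' ->
  stack_sort_rec k p' = stack_sort_rec n' p' by move=> le; apply: (H n).
elim: k => [|k IHk] [|n'] [|x q] //= lek len.
have hi := largest_mem x q; rewrite -index_mem /= in hi.
have ht : size (take (index (largest (x :: q)) (x :: q)) (x :: q)) <= size q.
  by rewrite size_take /= hi -ltnS.
have hd : size (drop (index (largest (x :: q)) (x :: q)) q) <= size q.
  by rewrite size_drop leq_subr.
have [lk ln] : size q <= k /\ size q <= n' by split; rewrite -ltnS.
congr (_ ++ _); first by apply: IHk; apply: leq_trans ht _.
by congr (_ ++ _); apply: IHk; apply: leq_trans hd _.
Qed.

Lemma stack_sort_nil : stack_sort [::] = [::].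
Proof. by []. Qed.

Lemma stack_sort_max L m R :
  all (fun x => x < m) (L ++ R) ->
  stack_sort (L ++ m :: R) = stack_sort L ++ stack_sort R ++ [:: m].
Proof.
rewrite all_cat => /andP[/allP hL /allP hR].
have mE : largest (L ++ m :: R) = m.
  apply/eqP; rewrite eqn_leq leq_largest ?mem_cat ?inE ?eqxx ?orbT // andbT.
  have: largest (L ++ m :: R) \in L ++ m :: R.
    by case: {hL} L => [|y L]; rewrite ?cat_cons; apply: largest_mem.
  by rewrite mem_cat inE => /or3P[/hL/ltnW | /eqP-> | /hR/ltnW].
have iE : index m (L ++ m :: R) = size L.
  rewrite index_cat /= eqxx addn0.
  by case: ifP => // /hL; rewrite ltnn.
rewrite {1}/stack_sort size_cat /= addnS.
have -> : forall n p, p != [::] -> stack_sort_rec n.+1 p =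
   stack_sort_rec n (take (index (largest p) p) p) ++
   stack_sort_rec n (drop (index (largest p) p).+1 p) ++ [:: largest p].
  by move=> n [].
- rewrite mE iE take_size_cat //.
  have ->: drop (size L).+1 (L ++ m :: R) = R.
    by rewrite -cat_rcons drop_size_cat ?size_rcons.
  by rewrite !stack_sort_recE ?leq_addl ?leq_addr.
- by case: (L).
Qed.

Lemma perm_stack_sort p : perm_eq (stack_sort p) p.
Proof.
suff H n q : size q <= n -> perm_eq (stack_sort_rec n q) q by exact: H.
elim: n q => [|n IHn] [|x q] // le; rewrite /stack_sort_rec -/stack_sort_rec.
set p' := x :: q; set i := index _ _.
have hi : i < size p' by rewrite index_mem largest_mem.
have ni : nth 0 p' i = largest p' by rewrite nth_index ?largest_mem.
have ht : size (take i p') <= n.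
  by rewrite size_take hi -ltnS (leq_trans hi le).
have hd : size (drop i.+1 p') <= n.
  by rewrite size_drop leq_subLR (leq_trans le) // addSn ltnS leq_addl.
have pE : p' = take i p' ++ largest p' :: drop i.+1 p'.
  by rewrite -ni -drop_nth // cat_take_drop.
rewrite [X in perm_eq _ X]pE.
apply: perm_cat; first exact: IHn.
by rewrite cats1 perm_rcons perm_cons IHn.
Qed.

Lemma mem_preimages p q :
  is_permutation p ->
  (q \in preimages p) = is_permutation q && (stack_sort q == p).
Proof.
move=> hp; rewrite mem_filter mem_permutations andbC.
case: eqP => [sq|]; last by rewrite !andbF.
have pq : perm_eq q p by rewrite -sq perm_sym perm_stack_sort.
by move: hp; rewrite pq /is_permutation (perm_uniq pq) (perm_all _ pq) => ->.
Qed.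

Lemma uniq_preimages p : uniq (preimages p).
Proof. by rewrite filter_uniq ?permutations_uniq. Qed.

(* Main.v *)
(* Let f_P(l) be the fertility of P followed by l increasing larger entries.
   Cutting a preimage at its largest entry shows that f_P is the Catalan
   sequence C when P is empty, that appending a new maximum to P shifts f_P by
   one place (D f = (f - f(0))/z on generating functions), and that
   f_{AmB} = z * D f_A * f_B when m is the largest entry of AmB and B is
   nonempty. Hence, up to a factor z^k, each f_P with P nonempty lies in the
   closure of D C under products and D, and the fertility numbers are the
   constant coefficients of such series. These series are positive and
   nondecreasing, so the list of their coefficients up to 126 can be computed
   from the corresponding lists of the factors; starting from D C only 301
   lists arise, and none has its first entry among the claimed infertility
   numbers. Conversely, products by D C and applications of D already produce
   all the other numbers above 1: 2j is the head of D((DC)^j), 4j + 1 of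
   D((DC)^(j-1) * D D C), 27 + 12b of D((DC)^b * D((DC)^3)), while 95 and 119
   are the heads of D D (DC * D D D C) and D D ((DC)^7). *)
Require Import Defs.
From mathcomp Require Import all_boot zify.

Set Implicit Arguments.
Unset Strict Implicit.
Unset Printing Implicit Defensive.

(** * Cutting preimages at their largest entry *)

Lemma mem_preimagesE p q : (q \in preimages p) = (stack_sort q == p).
Proof.
rewrite mem_filter mem_permutations andbC.
by case: eqP => [<-|]; rewrite ?andbF // perm_sym perm_stack_sort.
Qed.

Lemma all_stack_sort (a : pred nat) p : all a (stack_sort p) = all a p.
Proof. exact/perm_all/perm_stack_sort. Qed.

Lemma split_max p q m :
  all (fun x => x < m) p -> perm_eq q (rcons p m) ->
  exists L R, q = L ++ m :: R /\ all (fun x => x < m) (L ++ R).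
Proof.
move=> pm qp; have mq : m \in q by rewrite (perm_mem qp) mem_rcons mem_head.
case: (splitPr mq) qp => L R qp; exists L, R; split=> //.
suff /perm_all->: perm_eq (L ++ R) p by [].
rewrite -(perm_cons m); apply: (@perm_trans _ (L ++ m :: R)).
  by rewrite (perm_catCA [:: m] L R).
by rewrite perm_sym -perm_rcons perm_sym.
Qed.

(** A preimage has the form L m R with s(L) s(R) = [p], so it is determined by the place where [p]
    is cut and by a preimage of each piece. *)
Lemma preimages_rcons p m : all (fun x => x < m) p ->
  perm_eq (preimages (rcons p m))
    [seq LR.1 ++ m :: LR.2 | i <- iota 0 (size p).+1,
       LR <- [seq (L, R) | L <- preimages (take i p), R <- preimages (drop i p)]].
Proof.
move=> pm.
have sizeP X q : q \in preimages X -> size q = size X.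
  by rewrite mem_preimagesE => /eqP<-; rewrite (perm_size (perm_stack_sort _)).
have allP X q : q \in preimages X ->
    all (fun x => x < m) X -> all (fun x => x < m) q.
  by rewrite mem_preimagesE => /eqP<-; rewrite all_stack_sort.
have pmP i : all (fun x => x < m) (take i p) && all (fun x => x < m) (drop i p).
  by rewrite -all_cat cat_take_drop.
apply: uniq_perm; first exact: uniq_preimages.
  apply: allpairs_uniq_dep; first exact: iota_uniq.
    move=> i _; apply: allpairs_uniq; try exact: uniq_preimages.
    by move=> [a b] [c d] /=.
  move=> y y' /allpairsPdep[i [z [iltn /allpairsP[[L R] [hL hR zE]] yE]]].
  move=> /allpairsPdep[j [z' [jltn /allpairsP[[L' R'] /= [hL' hR' zE']] yE']]].
  rewrite {}yE {}yE' {}zE {}zE' /= in hL hR * => eLR.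
  have mN i' X : X \in preimages (take i' p) -> m \notin X.
    have [tm _] := andP (pmP i'); move=> /allP/(_ tm)/seq.allP Xm.
    by apply/negP => /Xm; rewrite ltnn.
  (* The position of [m] recovers the length of L, hence the cut. *)
  have sE : size L = size L'.
    have := congr1 (index m) eLR.
    by rewrite !index_cat (negPf (mN _ _ hL)) (negPf (mN _ _ hL')) /= eqxx !addn0.
  have ijE : i = j.
    by move: iltn jltn sE; rewrite !mem_iota !add0n !ltnS (sizeP _ _ hL)
         (sizeP _ _ hL') => /andP[_ ip] /andP[_ jp]; rewrite !size_takel.
  subst j; move/eqP: eLR; rewrite eqseq_cat // => /andP[/eqP-> /eqP[->]].
  by [].
move=> q; rewrite mem_preimagesE; apply/eqP/allpairsPdep.
  move=> sq; have qp : perm_eq q (rcons p m).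
    by rewrite -sq perm_sym perm_stack_sort.
  have [L [R [qE LRm]]] := split_max pm qp.
  move: sq; rewrite qE stack_sort_max // catA cats1 => /rcons_inj[pE].
  exists (size L), (L, R); split=> //.
    by rewrite mem_iota -pE size_cat (perm_size (perm_stack_sort L)) /=; lia.
  rewrite -pE; apply/allpairsP; exists (L, R); split=> //=.
    by rewrite mem_preimagesE take_size_cat // (perm_size (perm_stack_sort L)).
  by rewrite mem_preimagesE drop_size_cat // (perm_size (perm_stack_sort L)).
move=> [i [[L R] [ilt /allpairsP[[L' R'] /= [hL hR [-> ->]]] ->]]].
have [tm dm] := andP (pmP i); rewrite stack_sort_max.
  move: hL hR; rewrite !mem_preimagesE => /eqP-> /eqP->.
  by rewrite catA cat_take_drop cats1.
by rewrite all_cat (allP _ _ hL) ?(allP _ _ hR).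
Qed.

Lemma fertility_rcons p m : all (fun x => x < m) p ->
  fertility (rcons p m) =
  \sum_(i < (size p).+1) fertility (take i p) * fertility (drop i p).
Proof.
move=> pm; rewrite /fertility (perm_size (preimages_rcons pm)).
rewrite size_allpairs_dep sumnE big_map.
rewrite -(big_mkord xpredT (fun i => fertility (take i p) * fertility (drop i p))).
by rewrite /index_iota subn0; apply: eq_bigr => i _; rewrite size_allpairs.
Qed.

(** * Decomposing the fertility at a descent *)

Lemma fertility_not_sorted A m B : B != [::] -> all (fun x => x < m) (A ++ B) ->
  fertility (A ++ m :: B) = 0.
Proof.
move=> Bn0 ABm; rewrite /fertility; case E: (preimages _) => [|q qs] //.
have: q \in preimages (A ++ m :: B) by rewrite E mem_head.
rewrite mem_preimagesE => {E} /eqP sq.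
have qp : perm_eq q (rcons (A ++ B) m).
  rewrite perm_sym (perm_trans _ (perm_stack_sort q)) // sq perm_rcons.
  by rewrite (perm_catCA [:: m] A B).
have [L [R [qE LRm]]] := split_max ABm qp.
(* The sorted word must end with its largest entry [m], but its last entry lies in [B]. *)
move: sq; rewrite qE stack_sort_max // catA cats1.
case/lastP: B => // B x in Bn0 ABm qp *.
rewrite -rcons_cons -rcons_cat => /rcons_inj[_ xm].
by move: ABm; rewrite all_cat all_rcons xm ltnn andbF.
Qed.

(** The cut between [X] and [Y] is counted in the first sum, hence the shift [i.+1] in the
    second. *)
Lemma sum_splits_cat (phi : seq nat -> seq nat -> nat) X Y :
  \sum_(i < (size (X ++ Y)).+1) phi (take i (X ++ Y)) (drop i (X ++ Y)) =
  \sum_(i < (size X).+1) phi (take i X) (drop i X ++ Y)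
  + \sum_(i < size Y) phi (X ++ take i.+1 Y) (drop i.+1 Y).
Proof.
rewrite -(big_mkord xpredT (fun i => phi (take i (X ++ Y)) (drop i (X ++ Y)))).
rewrite (@big_cat_nat _ _ _ (size X).+1) //=; last by rewrite size_cat; lia.
congr (_ + _); first rewrite big_mkord.
  apply: eq_bigr => i _; have iX : i <= size X by rewrite -ltnS.
  rewrite takel_cat // drop_cat; case: ltngtP iX => // ->.
  by rewrite subnn drop0 drop_size.
rewrite -{1}[(size X).+1]add0n big_addn big_mkord size_cat -addSn addKn.
apply: eq_bigr => i _; rewrite addnC addSnnS take_cat drop_cat.
by rewrite ltnNge leq_addr addKn.
Qed.

Lemma sum_triangle (g : nat -> nat -> nat) n :
  \sum_(i < n) \sum_(j < i.+1) g i j = \sum_(j < n) \sum_(i < n - j) g (i + j) j.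
Proof.
elim: n => [|n IHn]; first by rewrite !big_ord0.
rewrite big_ord_recr [RHS]big_ord_recr /= IHn subSnn big_ord1 add0n.
rewrite [X in _ + X]big_ord_recr /= addnA -big_split /=; congr (_ + _).
apply: eq_bigr => j _; rewrite subSn; last exact: ltnW.
by rewrite big_ord_recr /= subnK // ltnW.
Qed.

(* In the terminology of valid hook configurations, the hook of the descent
   from [m] to [B] ends at the entry number [j] of [T]. *)
Lemma fertility_hook A m B T :
  B != [::] -> all (fun x => x < m) (A ++ B) -> path ltn m T ->
  fertility (A ++ m :: B ++ T) =
  \sum_(j < size T) fertility (A ++ m :: drop j.+1 T) * fertility (B ++ take j T).
Proof.
move=> Bn0; have [n] := ubnP (size T); elim: n => // n IHn in A T *.
case/lastP: T => [|T t] sizeT ABm mT.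
  by rewrite cats0 big_ord0 fertility_not_sorted.
rewrite size_rcons ltnS in sizeT.
have [Am Bm] : all (fun x => x < m) A /\ all (fun x => x < m) B.
  by apply/andP; rewrite -all_cat.
have mT_lt_t : all (fun x => x < t) (m :: T).
  move: mT; rewrite -[path _ _ _]/(sorted ltn (rcons (m :: T) t)).
  by rewrite (sorted_pairwise ltn_trans) pairwise_rcons => /andP[].
have lt_t X : all (fun x => x < m) X -> all (fun x => x < t) X.
  by apply: sub_all => x xm; apply: (ltn_trans xm); case/andP: mT_lt_t.
move: mT; rewrite rcons_path => /andP[mT _].
pose phi U V := fertility U * fertility V.
(* Cut at the last entry [t]: the cut falls inside [A] or just before [m], after [m] within [B], or
   inside [T]. *)
rewrite -rcons_cat -rcons_cons -rcons_cat fertility_rcons; last first.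
  case/andP: mT_lt_t => mt Tt.
  by rewrite all_cat /= all_cat (lt_t _ Am) (lt_t _ Bm) mt.
rewrite (sum_splits_cat phi A) /= (sum_splits_cat (fun U => phi (A ++ m :: U))).
(* A cut further inside or at the end of [B] leaves on the left a descent with no larger entry after
   it; only the cut right after [m] survives. It is the summand where the hook ends at [t]. *)
have -> : \sum_(i < (size B).+1) phi (A ++ m :: take i B) (drop i B ++ T) =
    phi (A ++ [:: m]) (B ++ T).
  rewrite big_ord_recl take0 drop0 big1 ?addn0 // => i _.
  rewrite /phi fertility_not_sorted //.
    by case: B Bn0 {IHn ABm Bm} i.
  by rewrite all_cat Am /=; apply/allP => x /mem_take; exact: (allP Bm).
rewrite size_rcons [RHS]big_ord_recr /=.
rewrite drop_oversize ?size_rcons // -{3}cats1 take_size_cat //.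
rewrite addnCA [RHS]addnC; congr (_ + _).
(* In the other summands, the factor that still contains [t] is cut at [t] as well; cuts in [A] and
   in [T] are then matched separately by induction. *)
transitivity (\sum_(j < size T) (\sum_(i < (size A).+1)
    fertility (take i A) * fertility (drop i A ++ m :: drop j.+1 T) +
    \sum_(i < size T - j) fertility (A ++ m :: take i (drop j.+1 T)) *
       fertility (drop i (drop j.+1 T))) * fertility (B ++ take j T)); last first.
  apply: eq_bigr => j _ /=; rewrite drop_rcons //.
  rewrite (_ : take j _ = take j T); last first.
    by rewrite -cats1 takel_cat // ltnW.
  congr (_ * _); rewrite -rcons_cons -rcons_cat fertility_rcons; last first.
    rewrite all_cat lt_t //=; case/andP: mT_lt_t => -> /allP Tt.
    by apply/allP => x /mem_drop/Tt.
  rewrite (sum_splits_cat phi A) /= size_drop; congr (_ + _).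
  by rewrite /phi subnSK.
under [RHS]eq_bigr do rewrite mulnDl.
rewrite big_split /=; congr (_ + _).
  under eq_bigr => i _.
    rewrite /phi IHn //; last first.
      by rewrite all_cat Bm andbT; apply/allP => x /mem_drop; exact: (allP Am).
    rewrite big_distrr /=; over.
  rewrite exchange_big /=; apply: eq_bigr => j _.
  by rewrite big_distrl /=; apply: eq_bigr => i _; rewrite mulnA.
under eq_bigr => i _.
  rewrite /phi IHn //; first last.
  - by rewrite take_path.
  - by rewrite size_takel // (leq_ltn_trans (ltn_ord i)).
  rewrite size_takel // big_distrl /=; over.
(* A cut after entry [i] of [T] allows hooks ending at [j <= i]; exchanging the two sums puts the
   hook first. *)
pose g i j := fertility (A ++ m :: drop j.+1 (take i.+1 T)) *
  fertility (B ++ take j (take i.+1 T)) * fertility (drop i.+1 T).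
rewrite (sum_triangle g); apply: eq_bigr => j _.
rewrite big_distrl; apply: eq_bigr => i _ /=.
rewrite /g take_drop drop_drop !addnS take_takel; last exact/leqW/leq_addl.
by rewrite mulnAC.
Qed.

(** * Catalan numbers and fertility series *)

(** This counts the stack-sortable permutations of length [n]; the Catalan recurrence is
    [catalanS]. *)
Definition catalan n := fertility (iota 1 n).

Lemma sorted_ltn_rcons T t :
  sorted ltn (rcons T t) = all (fun x => x < t) T && sorted ltn T.
Proof. by rewrite !(sorted_pairwise ltn_trans) pairwise_rcons. Qed.

Lemma eq_fertility_sorted T U : sorted ltn T -> sorted ltn U ->
  size T = size U -> fertility T = fertility U.
Proof.
have [n] := ubnP (size T); elim: n => // n IHn in T U *.
case/lastP: T => [|T t]; first by move=> _ _ _ /esym/size0nil->.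
case/lastP: U => [|U u]; first by rewrite size_rcons.
rewrite !size_rcons ltnS !sorted_ltn_rcons => Tn /andP[Tt sT] /andP[Uu sU] [TU].
rewrite !fertility_rcons // TU; apply: eq_bigr => i _.
have iU : i <= size U by rewrite -ltnS.
congr (_ * _); apply: IHn.
- by rewrite size_takel ?TU // (leq_ltn_trans iU) // -TU.
- exact: (take_sorted).
- exact: (take_sorted).
- by rewrite !size_takel ?TU.
- by rewrite size_drop (leq_ltn_trans (leq_subr _ _)).
- exact: drop_sorted.
- exact: drop_sorted.
- by rewrite !size_drop TU.
Qed.

Lemma fertility_sorted T : sorted ltn T -> fertility T = catalan (size T).
Proof.
by move=> sT; apply: eq_fertility_sorted; rewrite ?iota_ltn_sorted ?size_iota.
Qed.

Lemma catalanS n :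
  catalan n.+1 = \sum_(i < n.+1) catalan i * catalan (n - i).
Proof.
have : sorted ltn (rcons (iota 1 n) n.+1).
  by rewrite -cats1 -[[:: _]]/(iota (1 + n) 1) -iotaD iota_ltn_sorted.
rewrite sorted_ltn_rcons => /andP[lt_n sn].
rewrite {1}/catalan -[in LHS](addn1 n) iotaD cats1 fertility_rcons // size_iota.
apply: eq_bigr => i _; have ile : i <= n by rewrite -ltnS.
by rewrite !fertility_sorted ?take_sorted ?drop_sorted // size_takel
  ?size_drop size_iota.
Qed.

(* [f l] is the fertility of [P] followed by [l] increasing larger entries. *)
Definition tail_series P (f : nat -> nat) :=
  forall T, sorted ltn T -> all (fun t => all (fun x => x < t) P) T ->
  fertility (P ++ T) = f (size T).

Definition convolution (f g : nat -> nat) n := \sum_(j < n.+1) f (n - j) * g j.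

(** The generating function is z * D f * g; the constant term vanishes because a hook needs a larger
    entry to end at. *)
Definition hook_series (f g : nat -> nat) l :=
  if l is n.+1 then convolution (fun i => f i.+1) g n else 0.

Lemma tail_series_fertility P f : tail_series P f -> fertility P = f 0.
Proof. by move=> Pf; have := Pf [::] isT isT; rewrite cats0. Qed.

Lemma tail_series_nil : tail_series [::] catalan.
Proof. by move=> T sT _; rewrite fertility_sorted. Qed.

Lemma tail_series_rcons P f m : all (fun x => x < m) P -> tail_series P f ->
  tail_series (rcons P m) (fun i => f i.+1).
Proof.
move=> Pm Pf T sT Tm; rewrite cat_rcons Pf //=.
  rewrite path_min_sorted //; apply: sub_all Tm => t.
  by rewrite all_rcons => /andP[].
by rewrite Pm; apply: sub_all Tm => t; rewrite all_rcons => /andP[].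
Qed.

Lemma tail_series_hook A m B f g : B != [::] -> all (fun x => x < m) (A ++ B) ->
  tail_series A f -> tail_series B g ->
  tail_series (A ++ m :: B) (hook_series f g).
Proof.
move=> Bn0 ABm Af Bg T sT Tabove.
have [TA mT TB] : [/\ all (fun t => all (fun x => x < t) A) T,
    all (fun t => m < t) T & all (fun t => all (fun x => x < t) B) T].
  by split; apply: sub_all Tabove => t; rewrite all_cat => /and3P[].
have mTp : path ltn m T by rewrite path_min_sorted.
rewrite -catA cat_cons fertility_hook //.
(* The entry [m] belongs to the increasing tail of [A], so that tail has length [size T - j]. *)
have term (j : 'I_(size T)) :
    fertility (A ++ m :: drop j.+1 T) * fertility (B ++ take j T) =
    f (size T - j) * g j.
  rewrite Af ?Bg ?take_sorted //=.
  - by rewrite size_drop subnSK // size_takel // ltnW.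
  - by apply/allP => t /mem_take; apply: (allP TB).
  - rewrite path_min_sorted ?drop_sorted //.
    by apply/allP => t /mem_drop; apply: (allP mT).
  - move: ABm; rewrite all_cat => /andP[-> _] /=.
    by apply/allP => t /mem_drop; apply: (allP TA).
rewrite (eq_bigr _ (fun j _ => term j)).
case: (size T) => [|n] /=; first by rewrite big_ord0.
by apply: eq_bigr => j _; rewrite subSn // -ltnS.
Qed.

(** * Series truncated at 126 *)

(* [s] lists the values [<= 126] of the nondecreasing function [f]. *)
Definition leads (s : seq nat) (f : nat -> nat) :=
  [/\ 0 < f 0, {homo f : i j / i <= j}, forall i, i < size s -> f i = nth 0 s i
    & 126 < f (size s)].

(** A truncated Cauchy product. At the length of the shorter list that factor already exceeds 126,
    and so does the product, since both constant terms are positive. *)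
Definition mul_leads (s t : seq nat) :=
  let c := mkseq
    (fun n => sumn [seq nth 0 s (n - j) * nth 0 t j | j <- iota 0 n.+1])
    (minn (size s) (size t)) in
  take (find (fun x => 126 < x) c) c.

Lemma eq_leads s f g : f =1 g -> leads s f -> leads s g.
Proof.
move=> fg [f0 fh fs fS]; split; rewrite -?fg //.
  by move=> i j ij; rewrite -!fg fh.
by move=> i si; rewrite -fg fs.
Qed.

Lemma leads_gt0 s f n : leads s f -> 0 < f n.
Proof. by case=> f0 fh _ _; apply: leq_trans f0 (fh _ _ _). Qed.

Lemma leads_behead s f : leads s f -> leads (behead s) (fun i => f i.+1).
Proof.
move=> [f0 fh fs fS]; have f1 n : 0 < f n by apply: leq_trans f0 (fh _ _ _).
split=> // [i j ij | i | ]; first exact: fh.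
  by rewrite size_behead nth_behead => si; apply: fs; lia.
by apply: leq_trans fS (fh _ _ _); rewrite size_behead leqSpred.
Qed.

Lemma leads_convolution s t f g :
  leads s f -> leads t g -> leads (mul_leads s t) (convolution f g).
Proof.
move=> sf tg; have f_gt0 n := leads_gt0 n sf; have g_gt0 n := leads_gt0 n tg.
case: sf tg => [_ fh fs fS] [_ gh gt gT].
have term_le n j : j < n.+1 -> f (n - j) * g j <= convolution f g n.
  by move=> jn; rewrite /convolution (bigD1 (Ordinal jn)) //= leq_addr.
rewrite /mul_leads; set c := mkseq _ _; set p := find _ _.
have cE n : n < minn (size s) (size t) -> nth 0 c n = convolution f g n.
  move=> ns; rewrite nth_mkseq // sumnE big_map.
  rewrite /convolution -(big_mkord xpredT (fun j => f (n - j) * g j)).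
  rewrite /index_iota subn0.
  rewrite big_seq [RHS]big_seq; apply: eq_bigr => j; rewrite mem_iota => jn.
  by rewrite fs ?gt //; lia.
have szc : size c = minn (size s) (size t) by rewrite size_mkseq.
have pc : p <= size c by apply: find_size.
have szp : size (take p c) = p by rewrite size_takel.
split.
- by apply: leq_trans (term_le 0 0 isT); rewrite muln_gt0 f_gt0 g_gt0.
- apply: (homo_leq leqnn leq_trans) => n.
  rewrite /convolution [leqRHS]big_ord_recr /= -[leqLHS]addn0 leq_add //.
  by apply: leq_sum => j _; rewrite leq_mul2r fh ?orbT // leq_sub2r.
- by rewrite szp => i ip; rewrite nth_take // cE // -szc (leq_trans ip).
rewrite szp; have [ltp|] := ltnP p (size c).
  by rewrite -cE -?szc //; apply: nth_find; rewrite has_find.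
move=> cp; have {}cp : p = minn (size s) (size t) by rewrite -szc; lia.
rewrite cp /minn; case: ifP => _.
  apply: leq_trans (term_le (size s) 0 isT).
  by rewrite subn0 (leq_trans fS) // leq_pmulr.
apply: leq_trans (term_le (size t) (size t) (leqnn _)).
by rewrite subnn (leq_trans gT) // leq_pmull.
Qed.

Definition expansion k s (f : nat -> nat) :=
  (forall i, i < k -> f i = 0) /\ leads s (fun i => f (k + i)).

Lemma expansion_shift k s f :
  expansion k.+1 s f -> expansion k s (fun i => f i.+1).
Proof. by case=> f0 sf; split=> // i ik; apply: f0. Qed.

Lemma expansion_behead s f :
  expansion 0 s f -> expansion 0 (behead s) (fun i => f i.+1).
Proof. by case=> _ /leads_behead sf; split. Qed.

Lemma expansion_hook k l s t f g :
  expansion k s (fun i => f i.+1) -> expansion l t g ->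
  expansion (k + l).+1 (mul_leads s t) (hook_series f g).
Proof.
move=> [f0 sf] [g0 tg]; split=> [[//|n] /= nkl|].
  apply: big1 => j _; have [jl|lj] := ltnP j l; first by rewrite g0 ?muln0.
  by rewrite f0 //; move: nkl lj (ltn_ord j); lia.
apply: eq_leads (leads_convolution sf tg) => n /=; rewrite /convolution.
pose h j := f (k + l + n - j).+1 * g j; rewrite -[RHS](big_mkord xpredT h).
(* Below [l] the factor [g] vanishes, and from [l + n.+1] on the other factor does; the middle range
   is the shifted convolution. *)
rewrite (@big_cat_nat _ _ _ l) //=; last by lia.
rewrite (@big_cat_nat _ _ _ (l + n.+1) l) //=; [|by lia|by lia].
have -> : \sum_(0 <= j < l) h j = 0.
  by rewrite big_nat big1 // => j /andP[_ jl]; rewrite /h g0 ?muln0.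
have -> : \sum_(l + n.+1 <= j < (k + l + n).+1) h j = 0.
  by rewrite big_nat big1 // => j jl; rewrite /h f0 //; lia.
rewrite add0n addn0 -{2}[l]add0n big_addn addKn big_mkord; apply: eq_bigr => j _.
rewrite /h [j + l]addnC; congr (f _.+1 * _); move: (ltn_ord j); lia.
Qed.

(** * The finite closure, and why it excludes the infertility numbers *)

Definition catalan_leads := [:: 1; 2; 5; 14; 42].

Lemma expansion_catalan : expansion 0 catalan_leads (fun i => catalan i.+1).
Proof.
have c0 : catalan 0 = 1 by [].
(* From here on only the recurrence and the value at 0 are used. *)
move: catalan c0 catalanS => c c0 cS.
pose sumE := (big_ord_recr, big_ord0).
have c1 : c 1 = 1 by rewrite cS !sumE /= c0.
have c2 : c 2 = 2 by rewrite cS !sumE /= c1 c0.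
have c3 : c 3 = 5 by rewrite cS !sumE /= c2 c1 c0.
have c4 : c 4 = 14 by rewrite cS !sumE /= c3 c2 c1 c0.
have c5 : c 5 = 42 by rewrite cS !sumE /= c4 c3 c2 c1 c0.
have c6 : c 6 = 132 by rewrite cS !sumE /= c5 c4 c3 c2 c1 c0.
split=> //; split; rewrite ?add0n ?c1 //=.
- apply: (homo_leq leqnn leq_trans) => n.
  by rewrite !add0n (cS n.+1) big_ord_recl /= c0 mul1n subn0 leq_addr.
- by do 5?[case=> //]; rewrite add0n.
- by rewrite c6.
Qed.

Definition infertile n :=
  [&& n %% 4 == 3, n \notin [:: 95; 119] & (n < 27) || (n %% 12 != 3)].

(* Together with the lists of length at most 1, this is the closure of
   [catalan_leads] under [mul_leads] and [behead], found by computer search.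
   Multiplication by [catalan_leads] maps [:: a; b] to [:: a; b + 2 * a], so
   the lists of length 2 form arithmetic progressions. *)
Definition long_leads : seq (seq nat) :=
  [:: [:: 1; 2; 5; 14; 42]; [:: 1; 4; 14; 48]; [:: 1; 6; 27; 110];
      [:: 1; 8; 44]; [:: 1; 10; 65]; [:: 1; 12; 90]; [:: 1; 14; 119];
      [:: 2; 5; 14; 42]; [:: 2; 9; 34; 123]; [:: 2; 13; 62]; [:: 2; 17; 98];
      [:: 4; 14; 48]; [:: 4; 20; 81]; [:: 4; 22; 96]; [:: 5; 14; 42];
      [:: 5; 24; 95]; [:: 6; 27; 110]; [:: 9; 34; 123]] ++
  [seq [:: ab.1; b] |
     ab <- [:: (1, 16); (2, 21); (4, 28); (4, 30); (5, 34); (6, 39); (8, 44);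
               (8, 48); (9, 52); (10, 53); (10, 65); (12, 84); (12, 90);
               (13, 62); (14, 42); (14, 48); (14, 119); (16, 112); (17, 98);
               (18, 113); (20, 81); (20, 126); (22, 96); (24, 95); (27, 110);
               (34, 123)],
     b <- [seq b <- iota ab.2 (127 - ab.2) | (b - ab.2) %% (2 * ab.1) == 0]].

(** The empty list stands for a series whose constant coefficient exceeds 126. One-entry lists are
    tested by arithmetic, longer ones by lookup. *)
Definition reachable (s : seq nat) :=
  match s with
  | [::] => true
  | [:: n] => if (0 < n) && (n <= 126) then ~~ infertile n else false
  | _ => s \in long_leads
  end.

Definition reachables : seq (seq nat) :=
  [::] :: [seq [:: n] | n <- iota 1 126 & ~~ infertile n] ++ long_leads.

Lemma reachable_behead : all (fun s => reachable (behead s)) reachables.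
Proof. by vm_compute. Qed.

Lemma reachable_mul :
  all (fun s => all (fun t => reachable (mul_leads s t)) reachables) reachables.
Proof. by vm_compute. Qed.

(** The empty list contributes the default head 0, which is harmless. *)
Lemma reachable_head : all (fun s => ~~ infertile (head 0 s)) reachables.
Proof. by vm_compute. Qed.

Lemma mem_reachables s : reachable s -> s \in reachables.
Proof.
case: s => [|n [|a s]] //; last first.
  by move=> rs; rewrite in_cons mem_cat; apply/or3P; constructor 3.
rewrite /reachable; case: ifP => // /andP[n_gt0 n_le] fn.
rewrite /reachables in_cons mem_cat map_f ?orbT // mem_filter fn mem_iota.
by rewrite n_gt0 ltnS.
Qed.

Lemma uniq_split_max P : uniq P -> P != [::] ->
  exists A m B, P = A ++ m :: B /\ all (fun x => x < m) (A ++ B).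
Proof.
case: P => // x P; move: (x :: P) (largest_mem x P) => {x}P mP uP _.
have le_max := @leq_largest P; move: (largest P) => m in mP le_max.
case: (splitPr mP) uP le_max => A B; rewrite uniq_catC /= cat_uniq.
rewrite mem_cat negb_or => /andP[/andP[mB mA] _] le_max.
exists A, m, B; split=> //; apply/allP => x xAB; rewrite ltn_neqAle le_max.
  rewrite andbT; apply: contraTneq xAB => ->.
  by rewrite mem_cat negb_or mA mB.
by move: xAB; rewrite !mem_cat inE => /orP[] ->; rewrite ?orbT.
Qed.

Lemma permutation_expansion P : uniq P -> P != [::] ->
  exists f k s, [/\ tail_series P f, expansion k s f & reachable s].
Proof.
have [n] := ubnP (size P); elim: n => // n IHn in P *.
move=> sP uP /(uniq_split_max uP)[A [m [B [PE ABm]]]]; subst P.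
have [sA sB] : size A < n /\ size B < n.
  by move: sP; rewrite size_cat /=; lia.
have [uA uB] : uniq A /\ uniq B.
  by move: uP; rewrite cat_uniq /= => /and4P[-> _ _ ->].
(* Only D f matters for [A]: it is D C when [A] is empty; otherwise D lowers the power of z, or
   drops the first coefficient when that power is 0. *)
have [f [k [s [Af sf rs]]]] : exists f k s,
    [/\ tail_series A f, expansion k s (fun i => f i.+1) & reachable s].
  have [->|An0] := eqVneq A [::].
    by exists catalan, 0, catalan_leads; split=> //;
      [exact: tail_series_nil | exact: expansion_catalan].
  have [f [[|k] [s [Af sf rs]]]] := IHn _ sA uA An0; last first.
    by exists f, k, s; split=> //; apply: expansion_shift.
  exists f, 0, (behead s); split=> //; first exact: expansion_behead.
  exact: (allP reachable_behead) (mem_reachables rs).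
have [BE|Bn0] := eqVneq B [::].
  rewrite BE cats0 in ABm *; exists (fun i => f i.+1), k, s; split=> //.
  by rewrite cats1; apply: tail_series_rcons.
have [g [l [t [Bg tg rt]]]] := IHn _ sB uB Bn0.
exists (hook_series f g), (k + l).+1, (mul_leads s t); split.
- exact: tail_series_hook.
- exact: expansion_hook.
- exact: (allP ((allP reachable_mul) _ (mem_reachables rs))) (mem_reachables rt).
Qed.

Lemma fertility_number_not_infertile n :
  fertility_number n -> n <= 126 -> ~~ infertile n.
Proof.
move=> [P [/andP[uP _] <-]]; have [->//|Pn0] := eqVneq P [::].
have [f [k [s [Pf [f0 [_ _ fs fS]] rs]]]] := permutation_expansion uP Pn0.
(* For k = 0 the fertility is the head of [s], or exceeds 126 if [s] is empty; for k > 0 it is 0. *)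
rewrite (tail_series_fertility Pf); case: k f0 fs fS => [_ fs fS f_le | k f0 *].
  have := (allP reachable_head) _ (mem_reachables rs).
  case: s fs fS {rs} => [|a s] fs fS; first by rewrite leqNgt fS in f_le.
  by rewrite -[f 0]/(f (0 + 0)) (fs 0).
by rewrite f0.
Qed.

(** * Realizing all remaining numbers *)

Definition realized s := exists P f k,
  [/\ is_permutation P, P != [::], tail_series P f & expansion k s f].

Lemma lt_largestS P : all (fun x => x < (largest P).+1) P.
Proof. by apply/allP => x /leq_largest. Qed.

Lemma is_permutation_insert_max A B :
  is_permutation (A ++ B) -> is_permutation (A ++ (largest (A ++ B)).+1 :: B).
Proof.
move=> /andP[uAB pAB]; set m := (largest _).+1.
have eAB : perm_eq (A ++ m :: B) (m :: A ++ B).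
  by rewrite perm_sym (perm_catCA [:: m] A B).
rewrite /is_permutation (perm_uniq eAB) (perm_all _ eAB) /= uAB pAB !andbT.
by apply/negP => /leq_largest; rewrite ltnn.
Qed.

(** Each new maximum appended to [P] removes one factor z. *)
Lemma realized_zero s : realized s -> exists P f,
  [/\ is_permutation P, P != [::], tail_series P f & expansion 0 s f].
Proof.
move=> [P [f [k]]]; elim: k => [|k IHk] in P f *; first by exists P, f.
move=> [pP _ Pf /expansion_shift sf].
apply: (IHk (rcons P (largest P).+1)) (fun i => f i.+1) _; split=> //.
- by rewrite -cats1; have := @is_permutation_insert_max P [::]; rewrite cats0; apply.
- by case: (P).
- by apply: tail_series_rcons => //; apply: lt_largestS.
Qed.

Lemma realized_catalan : realized catalan_leads.
Proof.
exists [:: 1], (fun i => catalan i.+1), 0; split=> //.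
  exact: (@tail_series_rcons [::] catalan 1 isT tail_series_nil).
exact: expansion_catalan.
Qed.

Lemma realized_behead s : realized s -> realized (behead s).
Proof.
move=> /realized_zero[P [f [pP _ Pf /expansion_behead sf]]].
exists (rcons P (largest P).+1), (fun i => f i.+1), 0; split=> //.
- by rewrite -cats1; have := @is_permutation_insert_max P [::]; rewrite cats0; apply.
- by case: (P).
- by apply: tail_series_rcons => //; apply: lt_largestS.
Qed.

(** A new maximum in front of [P] is a hook with empty left part, which contributes the factor D
    C. *)
Lemma realized_mul s : realized s -> realized (mul_leads catalan_leads s).
Proof.
move=> [P [f [k [pP Pn0 Pf sf]]]].
exists ((largest P).+1 :: P), (hook_series catalan f), (0 + k).+1; split=> //.
- exact: (@is_permutation_insert_max [::] P).
- apply: (@tail_series_hook [::]) => //; first exact: lt_largestS.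
  exact: tail_series_nil.
- exact: expansion_hook expansion_catalan sf.
Qed.

Definition mul_catalan n := iter n (mul_leads catalan_leads).

Lemma realized_mul_catalan n s : realized s -> realized (mul_catalan n s).
Proof. by move=> rs; elim: n => //= n IHn; apply: realized_mul. Qed.

Lemma realized_fertility n s : realized (n :: s) -> fertility_number n.
Proof.
move=> /realized_zero[P [f [pP _ Pf [_ [_ _ fs _]]]]].
by exists P; split=> //; rewrite (tail_series_fertility Pf) (fs 0).
Qed.

(** Since D C = 1 + 2z + ..., multiplying a + bz + ... by its k-th power gives linear coefficient b
    + 2ak. The three general branches use (a, b) = (1, 2), (2, 5) and (6, 27), yielding 2 + 2k, 5 +
    4k and 27 + 12k. *)
Definition witness n : seq nat :=
  if n == 1 then catalan_leads
  else if n == 95 then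
    behead (behead (mul_catalan 1 (behead (behead catalan_leads))))
  else if n == 119 then behead (behead (mul_catalan 6 catalan_leads))
  else if ~~ odd n then behead (mul_catalan (n./2).-1 catalan_leads)
  else if n %% 4 == 1 then behead (mul_catalan (n %/ 4).-1 (behead catalan_leads))
  else behead (mul_catalan ((n - 27) %/ 12) (behead (mul_catalan 2 catalan_leads))).

Lemma realized_witness n : realized (witness n).
Proof.
have rG := realized_catalan; have rB := realized_behead.
have rM := realized_mul_catalan.
rewrite /witness; case: ifP => _ //; case: ifP => _; first exact/rB/rB/rM/rB/rB.
case: ifP => _; first exact/rB/rB/rM.
case: ifP => _; first exact/rB/rM.
case: ifP => _; first exact/rB/rM/rB.
exact/rB/rM/rB/rM.
Qed.

Lemma head_witness :
  all (fun n => infertile n || (ohead (witness n) == Some n)) (iota 1 126).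
Proof. by vm_compute. Qed.

Lemma not_infertile_fertility_number n :
  n <= 126 -> ~~ infertile n -> fertility_number n.
Proof.
case: (posnP n) => [-> _ _|n_gt0 n_le /negPf fn].
  (* A descent followed by no larger entry has fertility 0. *)
  by exists [:: 2; 1].
have : n \in iota 1 126 by rewrite mem_iota n_gt0.
move=> /(allP head_witness); rewrite fn /=.
case E: (witness n) => [|a s] //= /eqP[aE].
by apply: (@realized_fertility n s); have := realized_witness n; rewrite E aE.
Qed.

Theorem theorem5p3 (f : nat) (hf : f <= 126) :
  infertility_number f <->
  [/\ f = 3 %[mod 4],
      f \notin [:: 95; 119]
    & f < 27 \/ f <> 3 %[mod 12]].
Proof.
have -> : infertility_number f <-> infertile f.
  split=> [nf|ff /fertility_number_not_infertile/(_ hf)]; last by rewrite ff.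
  by apply: contraT => /(not_infertile_fertility_number hf).
rewrite /infertile.
split=> [/and3P[/eqP-> -> /orP[-> | /eqP h]] | [h -> [->|/eqP h']]].
- by split; [| | left].
- by split; [| | right].
- by rewrite h.
- by rewrite h [_ != _]h' orbT.
Qed.
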